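(* If $G$ is an even Hamiltonian graph and $n\ge 4$, then the exponential graph $G^{K_n}$ has two edge-disjoint Hamiltonian cycles.
   Context: A graph means a finite simple undirected graph with at least one vertex. A graph is even if it has an even number of vertices. A cycle has length at least 3; a Hamiltonian cycle is a cycle containing every vertex, and a graph is Hamiltonian if it has a Hamiltonian cycle. $K_n$ is the complete graph on $n$ vertices. Exponential graph: for graphs $G$ and $H$ with $V(H)=\{w_1,\ldots,w_q\}$, the exponential graph $G^H$ has vertex set $\{(u_1,\ldots,u_q;w_j) : u_i\in V(G)\ (1\le i\le q),\ 1\le j\le q\}$, and two vertices $(u_1,\ldots,u_q;w_j)$ and $(v_1,\ldots,v_q;w_k)$ are adjacent if and only if either ($j=k$, $u_jv_j\in E(G)$, and $u_i=v_i$ for all $i\ne j$) or ($j\neq k$, $w_jw_k\in E(H)$, and $u_i=v_i$ for all $i$). *)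

(* Defs.v *)
From HB Require Import structures.
From mathcomp Require Import all_boot.

Set Implicit Arguments.
Unset Strict Implicit.
Unset Printing Implicit Defensive.

(* Non-emptiness is not a field: a Hamiltonian cycle has at least three
   vertices, so every Hamiltonian graph below is non-empty. *)
Record sgraph := SGraph {
  vertex :> finType;
  edge : rel vertex;
  edge_sym : symmetric edge;
  edge_irrefl : irreflexive edge
}.

Definition even_graph (G : sgraph) : bool := ~~ odd #|G|.

(* A cycle is given by the sequence of its vertices, the last one being
   joined to the first. *)
Definition graph_cycle (G : sgraph) (c : seq G) : Prop :=
  3 <= size c /\ ucycle (@edge G) c.

Definition hamiltonian_cycle (G : sgraph) (c : seq G) : Prop :=
  graph_cycle c /\ forall x : G, x \in c.

Definition hamiltonian (G : sgraph) : Prop :=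
  exists c : seq G, hamiltonian_cycle c.

(* Undirected edges, as two-element vertex sets, so that edge-disjointness
   does not depend on the direction in which a cycle is listed. *)
Definition cycle_edges (G : sgraph) (c : seq G) : {set {set G}} :=
  [set [set x; next c x] | x in c].

Definition edge_disjoint (G : sgraph) (c1 c2 : seq G) : Prop :=
  [disjoint cycle_edges c1 & cycle_edges c2].

Section Complete.

Variable n : nat.

Definition complete_edge : rel 'I_n := fun i j => i != j.

Lemma complete_edge_sym : symmetric complete_edge.
Proof. by move=> i j; rewrite /complete_edge eq_sym. Qed.

Lemma complete_edge_irrefl : irreflexive complete_edge.
Proof. by move=> i; rewrite /complete_edge eqxx. Qed.

Definition complete_graph : sgraph :=
  SGraph complete_edge_sym complete_edge_irrefl.

End Complete.

Section Exponential.

Variables G H : sgraph.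

(* The coordinates u_1, ..., u_q are indexed by the vertices of H themselves:
   (u_1, ..., u_q; w_j) is the pair of w_i |-> u_i and w_j. *)
Definition exp_vertex : finType := ({ffun H -> G} * H)%type.

Definition exp_edge : rel exp_vertex := fun a b =>
  let: (u, j) := a in
  let: (v, k) := b in
  [&& j == k, edge (u j) (v j) & [forall i, (i != j) ==> (u i == v i)]]
  || [&& j != k, edge j k & [forall i, u i == v i]].

Lemma exp_edge_sym : symmetric exp_edge.
Proof.
move=> [u j] [v k]; rewrite /exp_edge; case: (eqVneq j k) => [<-|njk] /=.
  rewrite !orbF edge_sym; congr (_ && _).
  by apply: eq_forallb => i; rewrite [u i == _]eq_sym.
rewrite edge_sym; congr (_ && _).
by apply: eq_forallb => i; rewrite eq_sym.
Qed.

Lemma exp_edge_irrefl : irreflexive exp_edge.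
Proof. by move=> [u j]; rewrite /exp_edge eqxx edge_irrefl. Qed.

Definition exp_graph : sgraph := SGraph exp_edge_sym exp_edge_irrefl.

End Exponential.

(* Main.v *)
Require Import Defs.
From mathcomp Require Import all_boot perm ssralg zmodp zify.

Set Implicit Arguments.
Unset Strict Implicit.
Unset Printing Implicit Defensive.

(* Fix a Hamiltonian cycle of [G], with successor map [succ] and alternating
   parity [par] (this is where [G] even is used). On the torus of all maps
   u : 'I_n -> G, the moves u_j |-> succ u_j and u_j |-> pred u_j are shared
   out between the two cycles by a sign depending on the parities of u_j and of
   one further "guide" coordinate; both resulting torus graphs are connected.
   When n is odd, each cycle ignores one direction at every vertex, so that the
   number of remaining directions is even. Inside the fibers K_n, match these
   directions in pairs, by two disjoint matchings. Each of the two unions of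
   moves and matchings is a disjoint union of closed trails, and as in Kotzig's
   theorem on Euler circuits with forbidden transitions, re-pairing two
   matching edges of one fiber merges two trails while avoiding the other
   matching. Finally the ignored directions are inserted in the middle of
   matching edges, giving two disjoint connected 2-regular graphs. *)

(** * Hamiltonicity of connected 2-regular graphs *)

(** A longest simple path contains all neighbors of its ends, by maximality, and its inner vertices
    have both neighbors on it; so it is closed under adjacency and spans [V]. One of the two
    neighbors of its head is not the second vertex and must then be the last one, which closes the
    cycle. *)
Lemma two_regular_hamiltonian (V : finType) (e : rel V) (x0 : V) :
    symmetric e -> irreflexive e ->
    (forall x, exists y z, y != z /\ e x =1 pred2 y z) ->
    (forall x y, connect e x y) ->
  exists c, [/\ 3 <= size c, ucycle e c & forall x, x \in c].
Proof.
move=> eC eI e2 eT.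
pose P k := [exists t : k.-tuple V, uniq t && sorted e t].
have exP : exists k, P k.
  by exists 1; apply/existsP; exists [tuple x0].
have ubP k : P k -> k <= #|V|.
  case/existsP=> t /andP[t_uniq _].
  by rewrite -(size_tuple t) -(card_uniqP t_uniq) max_card.
case: (ex_maxnP exP ubP) => k /existsP[t /andP[t_uniq t_path]] k_max.
have max_t s : uniq s -> sorted e s -> size s <= size t.
  move=> s_uniq s_path; rewrite size_tuple; apply: k_max.
  by apply/existsP; exists (in_tuple s); rewrite s_uniq.
move: (tval t) t_uniq t_path max_t => s {t k k_max exP ubP P}.
case: s => [|x p] s_uniq s_path max_s.
  by have /(_ isT isT) := max_s [:: x0].
have {}s_path : path e x p := s_path.
set s := x :: p in s_uniq max_s.
have s_step i : i.+1 < size s -> e (nth x s i) (nth x s i.+1).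
  by move=> lt_i; move/(pathP x): s_path => /(_ i lt_i).
have s_inner i w : i.+2 < size s -> e (nth x s i.+1) w ->
    w = nth x s i \/ w = nth x s i.+2.
  move=> lt_i; have [y [z [_ exyz]]] := e2 (nth x s i.+1).
  have lt_i1 : i.+1 < size s by apply: ltnW.
  have := s_step _ lt_i; rewrite exyz /= => next_i.
  have := s_step _ lt_i1; rewrite eC exyz /= => prev_i.
  have : nth x s i != nth x s i.+2.
    by rewrite nth_uniq // ?(ltnW lt_i1) // neq_ltn ltnS leqnSn.
  rewrite exyz /=.
  by case/orP: next_i => /eqP->; case/orP: prev_i => /eqP->;
    rewrite ?eqxx // => _ /orP[] /eqP->; auto.
have s_head w : e x w -> w \in s.
  move=> exw; apply/negPn/negP=> s'w.
  have : size (w :: s) <= size s by apply: max_s; rewrite /= ?s'w // eC exw.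
  by rewrite ltnn.
have s_last w : e (last x p) w -> w \in s.
  move=> elw; apply/negPn/negP=> s'w.
  have : size (rcons s w) <= size s.
    by apply: max_s; rewrite ?rcons_uniq ?s'w //= rcons_path s_path elw.
  by rewrite size_rcons ltnn.
have s_closed y z : e y z -> y \in s -> z \in s.
  move=> eyz s_y; have := eyz; rewrite -(nth_index x s_y).
  have := s_y; rewrite -index_mem; case: (index y s) => [|i] lt_i.
    exact: s_head.
  have [eq_i|lt_i2] := leqP (size s) i.+2.
    have -> : i.+1 = size p by apply/eqP; rewrite eqn_leq -ltnS lt_i -ltnS eq_i.
    by rewrite nth_last /=; apply: s_last.
  by case/s_inner=> // ->; apply: mem_nth; rewrite // ltnW // ltnW.
have s_all y : y \in s.
  have clo := intro_closed (sym_connect_sym eC) s_closed.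
  by rewrite -(closed_connect clo (eT x y)) mem_head.
have ends w : e x w -> index w s = 1 \/ index w s = size p.
  move=> exw; have := exw; rewrite eC -{1}(nth_index x (s_all w)).
  have := s_all w; rewrite -index_mem.
  have : index w s != 0.
    apply: contraTneq exw => w0; have := nth_index x (s_all w).
    by rewrite w0 /= => <-; rewrite eI.
  case: (index w s) => [//|i] _ lt_i.
  have [eq_i _|lt_i2] := leqP (size s) i.+2.
    by right; apply/eqP; rewrite eqn_leq -ltnS lt_i -ltnS eq_i.
  have lt_i1 : i < size s by rewrite ltnW // ltnW.
  case/s_inner=> // /eqP; rewrite -[x in X in X -> _]/(nth x s 0) nth_uniq //.
  by move/eqP <-; left.
have [y [z [neq_yz exyz]]] := e2 x.
have exy : e x y by rewrite exyz /= eqxx.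
have exz : e x z by rewrite exyz /= eqxx orbT.
have neq_i : index y s != index z s.
  apply: contraNneq neq_yz => eq_i.
  by rewrite -(nth_index x (s_all y)) eq_i nth_index.
have index_gt0 w : e x w -> 0 < index w s.
  move=> exw; rewrite lt0n; apply: contraTneq exw => w0.
  by have := nth_index x (s_all w); rewrite w0 /= => <-; rewrite eI.
have exl w : e x w -> index w s = size p -> e (last x p) x.
  move=> exw iw; rewrite eC; have := nth_index x (s_all w).
  by rewrite iw -[size p]/((size s).-1) nth_last /= => ->.
exists s; split=> //.
  have := index_gt0 _ exy; have := index_gt0 _ exz; move: neq_i.
  case: (ends _ exy) => ->; case: (ends _ exz) => -> /=; rewrite ?eqxx //;
    by case: (size p) => [|[]].
rewrite /ucycle s_uniq andbT /= rcons_path s_path /=.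
case: (ends _ exy) (ends _ exz) neq_i => iy [] iz; rewrite iy iz ?eqxx // => _.
- exact: exl exz iz.
- exact: exl exy iy.
Qed.

(** * Re-pairing edges to merge alternating closed trails *)

Lemma fixed_free_involution_even (V : finType) (f : V -> V) (C : {set V}) :
    {in C, forall x, [/\ f x \in C, f (f x) = x & f x != x]} ->
  ~~ odd #|C|.
Proof.
have [k leCk] := ubnP #|C|; elim: k => // k IH in C leCk * => fC.
have [->|[x Cx]] := set_0Vmem C; first by rewrite cards0.
have [Cfx fK fx] := fC x Cx.
have Cfx' : f x \in C :\ x by rewrite !inE fx.
move: leCk; rewrite (cardsD1 x) Cx (cardsD1 (f x) (C :\ x)) Cfx' /= negbK.
move=> lek.
apply: IH => [|y]; first by rewrite -ltnS ltnW // -ltnS ltnW.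
rewrite !inE => /and3P[yfx yx /fC[Cfy fyK fy]].
rewrite Cfy andbT; split=> //; apply/andP; split.
  by apply: contraNneq yx => /(congr1 f); rewrite fyK fK => ->.
by apply: contraNneq yfx => /(congr1 f); rewrite fyK => ->.
Qed.

(** When [f] and [g] are involutions with the same fixed points, the components are these fixed
    points and the closed trails alternating between [f]-edges and [g]-edges. *)
Definition link (V : finType) (f g : V -> V) : rel V :=
  fun x y => (y == f x) || (y == g x).

Lemma link_sym (V : finType) (f g : V -> V) :
  involutive f -> involutive g -> symmetric (link f g).
Proof.
move=> fK gK x y; rewrite /link.
by rewrite -(inj_eq (inv_inj fK)) fK -(inj_eq (inv_inj gK) y) gK !(eq_sym x).
Qed.

(** When [a], [g a], [c], [g c] are distinct, conjugating by the transposition replaces the edges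
    joining [a] to [g a] and [c] to [g c] by edges joining [a] to [c] and [g a] to [g c].
    Involutivity comes for free. *)
Definition swap (V : finType) (g : V -> V) (a c : V) : V -> V :=
  fun x => tperm (g a) c (g (tperm (g a) c x)).

Lemma swapK (V : finType) (g : V -> V) (a c : V) :
  involutive g -> involutive (swap g a c).
Proof. by move=> gK x; rewrite /swap tpermK gK tpermK. Qed.

Section Merge.

Variables (V : finType) (f g : V -> V).
Hypotheses (fK : involutive f) (gK : involutive g).
Hypothesis fix_fg : forall x, (g x == x) = (f x == x).

Let cut (K : seq V) x := if x \in K then x else g x.

(* Otherwise the cut component of [x] would be even, as a union of [f]-pairs,
   and odd, since only [x] lacks its [g]-partner. *)
Lemma cut_connect (K : seq V) (x : V) :
    (forall y, (g y \in K) = (y \in K)) -> f x != x ->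
    {in K, forall y, connect (link f g) x y -> y \in [:: x; g x]} ->
  connect (link f (cut K)) x (g x).
Proof.
move=> Kg fx Kx; set e := link f (cut K).
have cutK : involutive (cut K).
  by move=> y; rewrite {2}/cut; case: ifP => yK; rewrite /cut ?Kg yK ?gK.
have e_sub y z : connect e y z -> connect (link f g) y z.
  apply: connect_sub => {}y {}z /orP[] /eqP->.
    by rewrite connect1 // /link eqxx.
  by rewrite /cut; case: ifP => // _; rewrite connect1 // /link eqxx orbT.
pose moved := [pred y | f y != y].
have moved_closed : closed (link f g) moved.
  apply: (intro_closed (sym_connect_sym (link_sym fK gK))) => y z.
  rewrite !inE => /orP[] /eqP-> fy; first by rewrite fK eq_sym.
  by rewrite -fix_fg gK eq_sym fix_fg.
apply/negPn/negP => not_xgx.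
pose C := [set y | connect e x y].
have C_moved y : y \in C -> f y != y.
  by rewrite inE => /e_sub/(closed_connect moved_closed); rewrite !inE fx.
have evenC : ~~ odd #|C|.
  apply: (@fixed_free_involution_even _ f) => y Cy; split; rewrite ?C_moved //.
  move: Cy; rewrite !inE => /connect_trans-> //.
  by rewrite connect1 // /e /link eqxx.
have Cx : x \in C by rewrite inE connect0.
move: evenC; rewrite (cardsD1 x) Cx /= negbK; apply/negP.
apply: (@fixed_free_involution_even _ g) => y; rewrite !inE => /andP[yx xy].
have C_y : y \in C by rewrite inE.
have not_Ky : y \notin K.
  apply/negP=> Ky; have := Kx y Ky (e_sub _ _ xy); rewrite !inE (negPf yx) /=.
  by move/eqP=> y_gx; rewrite -y_gx xy in not_xgx.
split; [|exact: gK|by rewrite fix_fg C_moved].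
apply/andP; split.
  by apply: contraNneq not_xgx => gyx; rewrite -{2}gyx gK.
apply: connect_trans xy _; rewrite connect1 // /e /link /cut (negPf not_Ky).
by rewrite eqxx orbT.
Qed.

(** By [cut_connect], each of the two trails stays connected when its [g]-edge at [a] or [c] is
    removed, so the new edge joins them and no earlier connection is lost. *)
Lemma swap_merge (a c : V) :
    f a != a -> f c != c -> ~~ connect (link f g) a c ->
  [/\ swap g a c a = c, swap g a c (g c) = g a,
      {in [predC [:: a; g a; c; g c]], swap g a c =1 g},
      subrel (connect (link f g)) (connect (link f (swap g a c)))
    & connect (link f (swap g a c)) a c].
Proof.
move=> fa fc not_ac; pose K := [:: a; g a; c; g c].
set g' := swap g a c; pose t := tperm (g a) c.
have linkC := sym_connect_sym (link_sym fK gK).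
have ga : g a != a by rewrite fix_fg.
have gc : g c != c by rewrite fix_fg.
have linkg x : connect (link f g) x (g x).
  by rewrite connect1 // /link eqxx orbT.
have ac : a != c by apply: contraNneq not_ac => ->.
have agc : a != g c by apply: contraNneq not_ac => ->; rewrite linkC.
have gac : g a != c by apply: contraNneq not_ac => <-.
have gagc : g a != g c by rewrite (inj_eq (inv_inj gK)).
have tD x : x != g a -> x != c -> t x = x.
  by move=> xga xc; rewrite tpermD // eq_sym.
have g'a : g' a = c by rewrite /g' /swap -/t (tD a) ?tpermL // eq_sym.
have g'gc : g' (g c) = g a.
  by rewrite /g' /swap -/t (tD (g c)) ?gK ?tpermR // eq_sym.
have g'g : {in [predC K], g' =1 g}.
  move=> x; rewrite !inE !negb_or => /and4P[xa xga xc xgc].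
  rewrite /g' /swap -/t (tD x) // tD ?(inj_eq (inv_inj gK)) //.
  by rewrite -(inj_eq (inv_inj gK)) gK.
have g'K : involutive g' := swapK a c gK.
have linkg' x : connect (link f g') x (g' x).
  by rewrite connect1 // /link eqxx orbT.
have linkC' := sym_connect_sym (link_sym fK g'K).
have Kg y : (g y \in K) = (y \in K).
  rewrite !inE -!(inj_eq (inv_inj gK) (g y)) !gK.
  by do 4!case: (y == _).
have cut_sub : subrel (connect (link f (cut K))) (connect (link f g')).
  apply: connect_sub => x y /orP[] /eqP->.
    by rewrite connect1 // /link eqxx.
  by rewrite /cut; case: ifPn => // /g'g<-; apply: linkg'.
have conn_ac : connect (link f g') a c by rewrite -g'a.
have conn_gl x y : connect (link f g) (g x) y = connect (link f g) x y.
  by rewrite -(same_connect linkC (linkg x)).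
have conn_gr x y : connect (link f g) x (g y) = connect (link f g) x y.
  by rewrite linkC conn_gl linkC.
have conn_a : connect (link f g') a (g a).
  apply/cut_sub/cut_connect => // y; rewrite !inE => /or4P[] /eqP->;
    by rewrite ?eqxx ?orbT ?conn_gr // (negPf not_ac).
have conn_c : connect (link f g') c (g c).
  apply/cut_sub/cut_connect => // y; rewrite !inE => /or4P[] /eqP->;
    by rewrite ?eqxx ?orbT ?conn_gr // linkC (negPf not_ac).
split=> //; apply: connect_sub => x y /orP[] /eqP->.
  by rewrite connect1 // /link eqxx.
have [/g'g<-|/negPn] := boolP (x \in [predC K]); first exact: linkg'.
rewrite !inE => /or4P[] /eqP->; rewrite ?gK //; first by rewrite linkC'.
by rewrite linkC'.
Qed.

End Merge.

(* Kotzig's argument: of the two ways to reconnect two [g]-edges lying on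
   different cycles, at most one can meet an edge of the involution [h]. *)
Lemma avoiding_matching_connected (V : finType) (T : eqType) (pi : V -> T)
    (f h g : V -> V) :
    involutive f -> involutive h -> involutive g ->
    (forall x, pi (g x) = pi x) -> (forall x, (g x == x) = (f x == x)) ->
    (forall x, g x != h x) ->
  exists g', [/\ involutive g', forall x, pi (g' x) = pi x,
    forall x, (g' x == x) = (f x == x), forall x, g' x != h x
    & forall x y, pi x = pi y -> f x != x -> f y != y ->
        connect (link f g') x y].
Proof.
(* Induction on the number of ordered pairs not yet connected. *)
move=> fK hK; pose conn g := [set p | connect (link f g) p.1 p.2].
have [k] := ubnP #|~: conn g|; elim: k => // k IH in g * => ltk gK pig fixg gh.
pose bad p := [&& pi p.1 == pi p.2, f p.1 != p.1, f p.2 != p.2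
                & ~~ connect (link f g) p.1 p.2].
have [[a c0] /and4P[/= /eqP pi_ac fa fc0 not_ac0]|no_bad] :=
  pickP bad; last first.
  exists g; split=> // x y pixy fx fy.
  by have := no_bad (x, y); rewrite /bad /= pixy eqxx fx fy => /negPn.
(* The two ways to reconnect are [c = c0] and [c = g c0]. *)
have [c [pi_c fc not_ac hac hgac]] : exists c,
    [/\ pi c = pi a, f c != c, ~~ connect (link f g) a c,
        h a != c & h (g a) != g c].
  have fgc0 : f (g c0) != g c0 by rewrite -fixg gK eq_sym fixg.
  have not_agc0 : ~~ connect (link f g) a (g c0).
    apply: contraNN not_ac0 => /connect_trans->//.
    by rewrite connect1 // /link gK eqxx orbT.
  have a_ga : a != g a by rewrite eq_sym fixg.
  have c_gc : c0 != g c0 by rewrite eq_sym fixg.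
  have [hac|hac] := eqVneq (h a) c0.
    exists (g c0); rewrite pig gK hac; split=> //.
    by rewrite -hac (inj_eq (inv_inj hK)) eq_sym.
  have [hgac|hgac] := eqVneq (h (g a)) (g c0); last by exists c0.
  exists (g c0); rewrite pig gK hgac; split=> //; last by rewrite eq_sym.
  by rewrite -hgac (inj_eq (inv_inj hK)).
have [] := swap_merge fK gK fixg fa fc not_ac.
set g' := swap g a c => g'a g'gc g'g conn_g' conn_ac; pose t := tperm (g a) c.
have g'K : involutive g' := swapK a c gK.
apply: (IH g') => //.
- apply: (@leq_trans #|~: conn g|); last by rewrite -ltnS.
  rewrite proper_card // properC.
  apply/properP; split.
    by apply/subsetP=> p; rewrite !inE; apply: conn_g'.
  by exists (a, c); rewrite !inE.
- have pit x : pi (t x) = pi x.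
    by rewrite /t; case: tpermP => // ->; rewrite pig.
  by move=> x; rewrite /g' /swap pit pig pit.
- move=> x; rewrite /g' /swap -(inj_eq (inv_inj (tpermK (g a) c))) tpermK fixg.
  case: tpermP => [->|->|//]; last first.
    by rewrite -fixg gK eq_sym fixg (negPf fa) (negPf fc).
  by rewrite (negPf fc) -fixg gK eq_sym fixg (negPf fa).
move=> x; have [/g'g->//|/negPn] := boolP (x \in [predC [:: a; g a; c; g c]]).
have hC y z : (z == h y) = (h z == y) by rewrite -(inj_eq (inv_inj hK)) hK.
have g'c : g' c = a by rewrite -[X in g' X]g'a g'K.
have g'ga : g' (g a) = g c by rewrite -g'gc g'K.
rewrite !inE => /or4P[] /eqP->; rewrite ?g'a ?g'gc ?g'c ?g'ga.
- by rewrite eq_sym.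
- by rewrite eq_sym.
- by rewrite hC.
- by rewrite hC.
Qed.

(** * Adding the ignored directions to the matchings *)

(* Insert the fixed point [x] of the involution [m] in the middle of the edge
   joining [a] and [m a]. *)
Definition thread (I : finType) (m : I -> I) (x a : I) : rel I := fun j k =>
  if j == x then (k == a) || (k == m a)
  else if (j == a) || (j == m a) then k == x else k == m j.

(** What a fiber must provide for total degree 2: one edge at a moved point, which also has a torus
    move, and two at a fixed point, which has none. The condition [m k != k] attaches each fixed
    point to a moved one. *)
Definition spans (I : finType) (m : I -> I) (F : rel I) : Prop :=
  [/\ symmetric F, irreflexive F,
      forall j, m j != j -> exists k, F j =1 pred1 k,
      forall j, m j = j ->
        exists k l, [/\ k != l, m k != k & F j =1 pred2 k l]
    & forall j, connect F j (m j)].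

Lemma thread_spans (I : finType) (m : I -> I) (x a : I) :
    involutive m -> (forall j, (m j == j) = (j == x)) -> a != x ->
  spans m (thread m x a).
Proof.
move=> mK fix_m ax; have xa : x != a by rewrite eq_sym.
have mx : m x = x by apply/eqP; rewrite fix_m.
have mx_eq j : (m j == x) = (j == x) by rewrite -{1}mx (inj_eq (inv_inj mK)).
have max : m a != x by rewrite mx_eq.
have ama : a != m a by rewrite eq_sym fix_m.
have threadx k : thread m x a x k = (k == a) || (k == m a).
  by rewrite /thread eqxx.
have threada k : thread m x a a k = (k == x).
  by rewrite /thread (negPf ax) eqxx.
have threadma k : thread m x a (m a) k = (k == x).
  by rewrite /thread (negPf max) eqxx orbT.
have threadD j k : j != x -> j != a -> j != m a ->
    thread m x a j k = (k == m j).
  by rewrite /thread => /negPf-> /negPf-> /negPf->.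
have mC j k : (k == m j) = (m k == j) by rewrite -(inj_eq (inv_inj mK)) mK.
split=> [j k|j|j|j|j].
- have [->|jx] := eqVneq j x.
    have [->|kx] := eqVneq k x; first by [].
    rewrite threadx /thread (negPf kx).
    by rewrite eqxx (eq_sym x) mx_eq (negPf kx); case: ifP.
  have [->|kx] := eqVneq k x.
    rewrite threadx /thread (negPf jx).
    by rewrite eqxx (eq_sym x) mx_eq (negPf jx); case: ifP.
  rewrite /thread (negPf jx) (negPf kx) (eq_sym j (m k)) -mC.
  have m_inj := inj_eq (inv_inj mK).
  case: ifP => [ja|/norP[ja jma]]; case: ifP => [ka|/norP[ka kma]] //.
    by case/orP: ja => /eqP->; rewrite ?mK ?(negPf kma) ?(negPf ka).
  case/orP: ka => /eqP->; rewrite ?m_inj ?(eq_sym _ j) ?(negPf ja) //.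
  by rewrite mC eq_sym (negPf jma).
- rewrite /thread; case: eqP => [->|/eqP jx].
    by rewrite (negPf xa) eq_sym (negPf max).
  by case: ifP => // _; rewrite ?(negPf jx) // eq_sym fix_m (negPf jx).
- rewrite fix_m => jx.
  have [ja|] := boolP ((j == a) || (j == m a)).
    by exists x => k; rewrite /thread (negPf jx) ja.
  by case/norP=> ja jma; exists (m j) => k; rewrite threadD.
- move/eqP; rewrite fix_m => /eqP->; exists a, (m a).
  by rewrite fix_m.
have [->|jx] := eqVneq j x; first by rewrite mx.
have a_x : connect (thread m x a) a x by rewrite connect1 // threada.
have x_a : connect (thread m x a) x a by rewrite connect1 // threadx eqxx.
have ma_x : connect (thread m x a) (m a) x by rewrite connect1 // threadma.
have x_ma : connect (thread m x a) x (m a).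
  by rewrite connect1 // threadx eqxx orbT.
have [->|ja] := eqVneq j a; first exact: connect_trans a_x x_ma.
have [->|jma] := eqVneq j (m a).
  by rewrite mK; apply: connect_trans ma_x x_a.
by rewrite connect1 // threadD.
Qed.

Lemma card_avoid3 (I : finType) (x y z : I) :
  3 < #|I| -> exists a, [/\ a != x, a != y & a != z].
Proof.
move=> I4; have [a|all_in] := pickP [predC [:: x; y; z]].
  by rewrite !inE !negb_or => /and3P[ax ay az]; exists a.
move: I4; rewrite ltnNge -[3]/(size [:: x; y; z]).
case/negP; apply: leq_trans (card_size _); apply/subset_leq_card/subsetP=> a _.
by have := all_in a; rewrite !inE => /negbFE.
Qed.

Lemma disjoint_spans (I : finType) (M : bool -> I -> I) :
    (forall b, involutive (M b)) -> (forall j, M true j != M false j) ->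
    (forall b j, M b j != j) \/
      3 < #|I| /\ (exists x : bool -> I, x true != x false /\
                     forall b j, (M b j == j) = (j == x b)) ->
  exists F : bool -> rel I, (forall b, spans (M b) (F b)) /\
    forall j k, F true j k -> ~~ F false j k.
Proof.
move=> MK Mtf [fixM|[I4 [x [xtf fixM]]]].
  exists (fun b j k => k == M b j); split=> [b|j k /eqP->//].
  split=> [j k|j|j _|j /eqP|j].
  - by rewrite -(inj_eq (inv_inj (MK b))) MK eq_sym.
  - by rewrite eq_sym (negPf (fixM b j)).
  - by exists (M b j).
  - by rewrite (negPf (fixM b j)).
  - exact: connect1.
(* The partners of the inserted points in the opposite matchings: an inserted edge can clash only
   with one of these two matching edges or with another inserted edge. *)
pose p := M false (x true); pose q := M true (x false).
(* This keeps [p] off the edge into which [x true] is inserted. *)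
have [a [a_x a_p a_Mp]] := card_avoid3 (x true) p (M true p) I4.
(* If [x false] lies on the edge broken by [x true], its edge to [q] is gone and only an edge
   between the two inserted points must be avoided; otherwise the latter is no danger and [q] must
   be avoided. Either way three values are excluded among at least four. *)
have [c [c_x c_1 c_2]] : exists c,
  [/\ c != x false, x false \in [:: a; M true a] ->
      x true \notin [:: c; M false c]
      & x false \notin [:: a; M true a] -> q \notin [:: c; M false c]].
  have notin y z : z != y -> z != M false y -> y \notin [:: z; M false z].
    move=> zy zMy; rewrite !inE !(eq_sym y) (negPf zy) /=.
    by rewrite -(inj_eq (inv_inj (MK false))) MK (negPf zMy).
  have [a_xf|a_xf] := boolP (x false \in [:: a; M true a]).
    have [c [c1 c2 c3]] := card_avoid3 (x false) (x true) p I4.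
    by exists c; split=> // _; apply: notin.
  have [c [c1 c2 c3]] := card_avoid3 (x false) q (M false q) I4.
  by exists c; split=> // _; apply: notin.
exists (fun b => if b then thread (M true) (x true) a
                 else thread (M false) (x false) c).
split=> [[]|]; [by apply: thread_spans | by apply: thread_spans |].
move=> j k; rewrite /thread.
have a_xf : (x false == a) || (x false == M true a) ->
    ~~ ((x true == c) || (x true == M false c)).
  by move: c_1; rewrite !inE.
have a'xf : ~~ ((x false == a) || (x false == M true a)) ->
    ~~ ((q == c) || (q == M false c)).
  by move: c_2; rewrite !inE.
have a'p : ~~ ((p == a) || (p == M true a)).
  by rewrite !(eq_sym p) negb_or a_p -(inj_eq (inv_inj (MK true))) MK a_Mp.
have MtC y z : (y == M true z) = (z == M true y).
  by rewrite -(inj_eq (inv_inj (MK true))) MK eq_sym.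
have MfC y z : (y == M false z) = (z == M false y).
  by rewrite -(inj_eq (inv_inj (MK false))) MK eq_sym.
have [->|jxt] := eqVneq j (x true).
  rewrite (negPf xtf) => ka; have : k != p by apply: contraNneq a'p => <-.
  case: ifP => // xtc kp; apply: contraTneq xtc => kxf.
  by rewrite a_xf // -kxf.
have [->|jxf] := eqVneq j (x false).
  case: ifP => [a_f /eqP->|/negbT/a'xf cq /eqP->//]; exact: a_xf.
case: ifP => [ja /eqP->|/negbT ja /eqP->]; case: ifP => [jc|_] //.
  by rewrite MfC; apply: contraNneq a'p => jp; rewrite /p -jp.
rewrite eq_sym MtC -/q; apply: contraNneq ja => jq; rewrite jq in jc *.
have xfa : (x false == a) || (x false == M true a).
  by apply: contraTT jc => /a'xf.
by rewrite /q (inj_eq (inv_inj (MK true))) [_ == a]eq_sym MtC orbC.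
Qed.

(** * The two torus graphs and their connectedness *)

Section Torus.

Variables (G I : finType) (succ pred : G -> G) (par : G -> bool).
Hypotheses (succK : cancel succ pred) (predK : cancel pred succ).
Hypothesis par_succ : forall x, par (succ x) = ~~ par x.
Hypothesis succ_pred : forall x, succ x != pred x.
Hypothesis succ_conn : forall x y, fconnect succ x y.

Variables (h r t p q : I).
Hypotheses (hr : h != r) (rt : r != t) (th : t != h).
Hypotheses (p_hrt : p \notin [:: h; r; t]) (q_hrt : q \notin [:: h; r; t]).

Implicit Types (u v : {ffun I -> G}) (b : bool) (j k : I).

Definition upd u j (x : G) : {ffun I -> G} :=
  [ffun k => if k == j then x else u k].

(** The cyclic guidance among [h], [r], [t] ensures that no coordinate guides its own guide; all
    others follow [r], so as not to depend on [h]. *)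
Definition guide j : I :=
  if j == h then r else if j == r then t else if j == t then h else r.

(* The [j]-th coordinate moves up or down according to its parity and to that
   of its guide, so that moving the guide reverses the direction. *)
Definition step b j u : {ffun I -> G} :=
  let up := par (u j) (+) par (u (guide j)) (+) b in
  upd u j ((if up then succ else pred) (u j)).

(** The ignored direction depends on the parity of coordinate [h], so that moving [h] frees it; when
    [p] and [q] differ, the two cycles never ignore the same one. *)
Definition idle b u : I := if par (u h) (+) b then p else q.

Lemma par_pred x : par (pred x) = ~~ par x.
Proof. by rewrite -{2}(predK x) par_succ negbK. Qed.

Lemma guide_neq j : guide j != j.
Proof.
rewrite /guide; case: (eqVneq j h) => [->|jh]; first by rewrite eq_sym.
case: (eqVneq j r) => [->|jr]; first by rewrite eq_sym.
by case: (eqVneq j t) => [->|jt]; rewrite eq_sym.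
Qed.

Lemma guide2_neq j : guide (guide j) != j.
Proof.
have neqE := (negPf hr, negPf rt, negPf th, eq_sym r h, eq_sym t r, eq_sym h t).
rewrite {2}/guide; case: (eqVneq j h) => [->|jh].
  by rewrite /guide !neqE eqxx.
case: (eqVneq j r) => [->|jr]; first by rewrite /guide !neqE eqxx.
case: (eqVneq j t) => [->|jt]; first by rewrite /guide eqxx.
by rewrite /guide !neqE eqxx eq_sym.
Qed.

Lemma stepE b j u k : k != j -> step b j u k = u k.
Proof. by rewrite ffunE => /negPf->. Qed.

Lemma stepEj b j u : step b j u j =
  (if par (u j) (+) par (u (guide j)) (+) b then succ else pred) (u j).
Proof. by rewrite ffunE eqxx. Qed.

Lemma par_step b j u : par (step b j u j) = ~~ par (u j).
Proof. by rewrite stepEj; case: ifP; rewrite ?par_succ ?par_pred. Qed.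

(** The move flips the parity of coordinate [j] but not that of its guide, so the next move goes
    back. *)
Lemma stepK b j : involutive (step b j).
Proof.
move=> u; apply/ffunP=> k; have [->|kj] := eqVneq k j; last by rewrite !stepE.
rewrite stepEj par_step !addNb stepE ?guide_neq // stepEj.
by case: (_ (+) b); rewrite /= ?succK ?predK.
Qed.

Lemma step_neq b j u : step b j u != u.
Proof.
apply/eqP=> /(congr1 (fun v => par (v j))); rewrite par_step.
by case: (par _).
Qed.

Lemma step_disjoint j u : step true j u != step false j u.
Proof.
apply/eqP=> /ffunP/(_ j)/eqP; rewrite !stepEj addbT addbF.
have neqE := negPf (succ_pred (u j)).
by case: (_ (+) _); rewrite /= ?neqE // eq_sym neqE.
Qed.

Lemma idle_step b j u : j != h -> idle b (step b j u) = idle b u.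
Proof. by move=> jh; rewrite /idle stepE // eq_sym. Qed.

Variable full : bool.
Hypothesis pq : full || (p != q).

(** [full] is meant for an even number of coordinates, where nothing is ignored. *)
Definition active b u j : bool := full || (j != idle b u).

Lemma active_hrt b u j : j \in [:: h; r; t] -> active b u j.
Proof.
move=> j_hrt; apply/orP; right; apply: contraTneq j_hrt => ->.
by rewrite /idle; case: ifP.
Qed.

(** Only a move of [h] changes the ignored direction, and [h] itself is never ignored. This makes
    [torus_move] symmetric. *)
Lemma active_step b j u : active b (step b j u) j = active b u j.
Proof.
have [->|jh] := eqVneq j h; first by rewrite !active_hrt ?mem_head.
by rewrite /active idle_step.
Qed.

Definition torus_move b u v : bool :=
  [exists j, active b u j && (v == step b j u)].

Lemma torus_move_sym b : symmetric (torus_move b).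
Proof.
suff sub u v : torus_move b u v -> torus_move b v u.
  by move=> u v; apply/idP/idP; apply: sub.
case/existsP=> j /andP[uj /eqP->]; apply/existsP; exists j.
by rewrite active_step uj stepK eqxx.
Qed.

Lemma torus_move_step b u j :
  active b u j -> connect (torus_move b) u (step b j u).
Proof.
by move=> uj; rewrite connect1 //; apply/existsP; exists j; rewrite uj /=.
Qed.

Lemma guide_hrt j : guide j \in [:: h; r; t].
Proof. by rewrite /guide !inE; do 3?[case: ifP => _]; rewrite eqxx ?orbT. Qed.

Lemma guide_h j : guide j == h -> j == t.
Proof.
rewrite /guide; case: ifP => _; first by rewrite eq_sym (negPf hr).
case: ifP => _; first by rewrite (negPf th).
by case: ifP => // _; rewrite eq_sym (negPf hr).
Qed.

(* If the direction of [j] is wrong, move its guide, then [j], then its guide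
   back. *)
Lemma torus_move_succ_active b u j : active b u j ->
  connect (torus_move b) u (upd u j (succ (u j))).
Proof.
move=> uj; have [up|down] := boolP (par (u j) (+) par (u (guide j)) (+) b).
  by have := torus_move_step uj; rewrite /step up.
pose k := guide j; have kj : k != j := guide_neq j.
pose u1 := step b k u; pose u2 := step b j u1.
have act_k v : active b v k by apply: active_hrt; apply: guide_hrt.
(* Moving the guide keeps [j] active: only [h] could change that, and [h] guides [t] alone, which is
   never ignored. *)
have u1j : active b u1 j.
  have [kh|kh] := eqVneq k h; last by rewrite /active idle_step.
  by rewrite active_hrt // !inE guide_h ?orbT //; apply/eqP.
have -> : upd u j (succ (u j)) = step b k u2.
  apply/ffunP=> i; rewrite ffunE; case: (eqVneq i j) => [->|ij].
    rewrite stepE 1?eq_sym // stepEj -/k par_step addbN addNb.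
    rewrite stepE 1?eq_sym //.
    by rewrite down.
  (* The guide of [k] is neither [j] nor [k], so the second move of [k] undoes the first. *)
  have [->|ik] := eqVneq i k; last by rewrite !stepE.
  rewrite stepEj [u2 k]stepE // [u2 (guide k)]stepE ?guide2_neq //.
  by rewrite -stepEj stepK.
apply: connect_trans (torus_move_step (act_k u)) _.
apply: connect_trans (torus_move_step u1j) _.
exact: torus_move_step.
Qed.

(** If [j] is ignored at [u], moving [h] up makes the other of [p] and [q] the ignored one; then [j]
    can move, and [h] is moved back. *)
Lemma torus_move_succ b u j : connect (torus_move b) u (upd u j (succ (u j))).
Proof.
have [uj|not_uj] := boolP (active b u j); first exact: torus_move_succ_active.
have jh : j != h.
  by apply: contraNneq not_uj => ->; rewrite active_hrt ?mem_head.
have act_h v : active b v h by rewrite active_hrt ?mem_head.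
pose u1 := upd u h (succ (u h)).
have u1j : active b u1 j.
  have /norP[_ /negPn/eqP j_idle] := not_uj.
  move: pq not_uj; rewrite /active negb_or => pq' /andP[full' _].
  rewrite (negPf full') /= in pq' *.
  rewrite j_idle /idle ffunE eqxx par_succ addNb.
  by case: (_ (+) b); rewrite //= eq_sym.
have moveC := sym_connect_sym (@torus_move_sym b).
apply: connect_trans (torus_move_succ_active (act_h u)) _; rewrite -/u1.
apply: connect_trans (torus_move_succ_active u1j) _; rewrite moveC.
set v := upd u j _.
have -> : upd u1 j (succ (u1 j)) = upd v h (succ (v h)).
  apply/ffunP=> i; rewrite !ffunE (negPf jh) [h == j]eq_sym (negPf jh).
  by case: (eqVneq i j) => [->|//]; rewrite (negPf jh).
exact: torus_move_succ_active.
Qed.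

(** Coordinates are corrected one at a time, each through iterates of [succ], which reach all of
    [G]. *)
Lemma torus_move_connected b u v : connect (torus_move b) u v.
Proof.
have upd_conn w j x : connect (torus_move b) w (upd w j x).
  rewrite -(iter_findex (succ_conn (w j) x)).
  elim: (findex _ _ _) => /= [|n IH].
    have -> : upd w j (w j) = w; last exact: connect0.
    by apply/ffunP=> i; rewrite ffunE; case: eqP => [->|].
  apply: connect_trans IH _; set y := iter n succ _.
  have -> : upd w j (succ y) = upd (upd w j y) j (succ (upd w j y j)).
    by apply/ffunP=> i; rewrite !ffunE eqxx; case: eqP.
  exact: torus_move_succ.
suff conn (s : seq I) :
    connect (torus_move b) u [ffun i => if i \in s then v i else u i].
  have := conn (enum I); congr connect.
  by apply/ffunP=> i; rewrite ffunE mem_enum.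
elim: s => [|j s IH].
  have -> : [ffun i => if i \in [::] then v i else u i] = u;
    last exact: connect0.
  by apply/ffunP=> i; rewrite ffunE.
apply: connect_trans IH _; set w := finfun _.
have -> : [ffun i => if i \in j :: s then v i else u i] = upd w j (v j).
  by apply/ffunP=> i; rewrite !ffunE inE; case: eqP => // ->.
exact: upd_conn.
Qed.

End Torus.

(** * Successor, predecessor and parity along a Hamiltonian cycle *)

Section Cycle.
Variables (V : finType) (c : seq V).
Hypotheses (c_uniq : uniq c) (c_all : forall x, x \in c).

(** Even length matters where the cycle wraps, from the odd index [(size c).-1] to 0. *)
Lemma odd_index_next (x : V) : ~~ odd (size c) ->
  odd (index (next c x) c) = ~~ odd (index x c).
Proof.
have := c_all x; rewrite next_nth => c_x; rewrite c_x.
case: c c_uniq c_x => // y s s_uniq s_x.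
have := s_x; rewrite -index_mem; move: (index x _) => i.
rewrite leq_eqVlt eqSS => /predU1P[-> |lt_i] odd_s.
  by rewrite nth_default //= eqxx (negbNE odd_s : odd (size s)).
by rewrite -[nth y s i]/(nth y (y :: s) i.+1) index_uniq.
Qed.

Lemma next_connect (x y : V) : fconnect (next c) x y.
Proof. by rewrite (fconnect_cycle (cycle_next c_uniq)). Qed.

(** Otherwise [x] and [next c x] would form a set closed under [next c], hence all of [V]. *)
Lemma next_neq_prev (x : V) : 2 < size c -> next c x != prev c x.
Proof.
apply: contraTneq => nx; rewrite -leqNgt -[2]/(size [:: x; next c x]).
apply: uniq_leq_size => // y _.
have nnx : next c (next c x) = x by rewrite nx next_prev.
have clo : closed (frel (next c)) [:: x; next c x].
  apply: intro_closed; first exact: fconnect_sym (can_inj (prev_next c_uniq)).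
  by move=> u v /eqP<-; rewrite !inE => /orP[] /eqP->; rewrite ?nnx eqxx ?orbT.
by rewrite -(closed_connect clo (next_connect x y)) mem_head.
Qed.

End Cycle.

(** * Reflections of the integers modulo [n.+1] *)

Section Reflection.

Variable n : nat.
Local Open Scope ring_scope.
Import GRing.Theory.

Lemma reflectK (c : 'I_n.+1) : involutive (fun j => c - j).
Proof. by move=> j; rewrite subKr. Qed.

Lemma reflect_neq (c d j : 'I_n.+1) : c != d -> c - j != d - j.
Proof. by rewrite (inj_eq (addIr _)). Qed.

(** A fixed point would make [c] congruent to [j + j] modulo the even number [n.+1], hence even. *)
Lemma even_reflect_free (c j : 'I_n.+1) : odd n -> odd c -> c - j != j.
Proof.
move=> n_odd c_odd; rewrite subr_eq; apply: contraTneq c_odd => ->.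
have := congr1 odd (divn_eq (j + j)%N n.+1).
by rewrite !oddD addbb oddM /= n_odd andbF addFb => <-.
Qed.

(** Doubling is injective modulo the odd number [n.+1]. *)
Lemma odd_reflect_fixed (p j : 'I_n.+1) :
  ~~ odd n -> (p + p - j == j) = (j == p).
Proof.
move=> n_even; rewrite subr_eq; apply/eqP/eqP => [|->//] /(congr1 val) /=.
have := ltn_ord p; have := ltn_ord j => ltj ltp eq_pj; apply: val_inj => /=.
move: eq_pj ltj ltp n_even; move: (val p) (val j) => /= {}p {}j.
(* A doubled residue wraps at most once, which leaves linear arithmetic. *)
have modE x : (x < n.+1)%N ->
    ((x + x) %% n.+1 = if (x + x < n.+1)%N then x + x else x + x - n.+1)%N.
  move=> ltx; case: ifP => [/modn_small//|/negbT]; rewrite -leqNgt => le_x.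
  by rewrite -{1}(subnK le_x) modnDr modn_small // ltn_subLR //; lia.
move=> eq_pj ltj ltp; move: eq_pj; rewrite !modE //; do 2!case: ifP; lia.
Qed.

End Reflection.

(** * Combining torus moves and fiber matchings *)

Section TwoRegular.

Variables (G : finType) (succ pred : G -> G) (par : G -> bool).
Hypotheses (succK : cancel succ pred) (predK : cancel pred succ).
Hypothesis par_succ : forall x, par (succ x) = ~~ par x.
Hypothesis succ_pred : forall x, succ x != pred x.
Hypothesis succ_conn : forall x y, fconnect succ x y.

Variable m : nat.
Hypothesis m_ge3 : 2 < m.

Let I : finType := 'I_m.+1.
Let coord i : I := inord i.
Let h := coord 0.
Let r := coord 1.
Let t := coord 2.
Let p := coord 3.
(** For [m = 3] this is [p], but then [full] holds; an even [m] is at least 4, so [p] and [q] differ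
    when it matters. *)
Let q := coord m.
Let full := odd m.
Let stp := step succ pred par h r t.
Let idl := @idle G I par h p q.
Let act := @active G I par h p q full.
Let V : finType := ({ffun I -> G} * I)%type.

Let coord_eq i j : i <= m -> j <= m -> (coord i == coord j) = (i == j).
Proof. by move=> im jm; rewrite -val_eqE /= !inordK. Qed.

Let le_m i : i <= 3 -> i <= m.
Proof. by move=> i3; apply: leq_trans m_ge3. Qed.

Let hr : h != r. Proof. by rewrite coord_eq ?le_m. Qed.
Let rt : r != t. Proof. by rewrite coord_eq ?le_m. Qed.
Let th : t != h. Proof. by rewrite coord_eq ?le_m. Qed.
Let rp : r != p. Proof. by rewrite coord_eq ?le_m. Qed.
Let p_hrt : p \notin [:: h; r; t].
Proof. by rewrite !inE !coord_eq ?le_m. Qed.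
Let q_hrt : q \notin [:: h; r; t].
Proof. by rewrite !inE !coord_eq ?leqnn ?le_m //; move: m_ge3; lia. Qed.
Let pq : full || (p != q).
Proof.
by rewrite coord_eq // /full; case: eqP => [<-|]; rewrite ?orbT.
Qed.

(** At [(u, j)] only the torus move in direction [j] is available, as in the exponential graph;
    vertices with an ignored direction become fixed points. *)
Let hop b (x : V) : V := if act b x.1 x.2 then (stp b x.2 x.1, x.2) else x.

Let hopK b : involutive (hop b).
Proof.
move=> [u j]; rewrite {2}/hop /=; case: ifP => uj; rewrite /hop /= ?uj //.
by rewrite /act active_step // -/act uj /stp stepK.
Qed.

Let hop_fixed b x : (hop b x == x) = ~~ act b x.1 x.2.
Proof.
case: x => u j; rewrite /hop /=; case: ifP; rewrite ?eqxx // => _.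
by apply/eqP=> -[]; apply/eqP; apply: step_neq.
Qed.

Import GRing.Theory.
Local Open Scope ring_scope.

(* [j |-> c - j] fixes no point when the order [m.+1] is even and [c] is odd,
   and fixes only [i] when the order is odd and [c = i + i]. *)
Let center b u : I :=
  if full then if b then r else p else idl b u + idl b u.

Let mate0 b (x : V) : V := (x.1, center b x.1 - x.2).

Let idle_tf u : ~~ full -> idl true u != idl false u.
Proof.
move=> /negPf not_full; move: pq; rewrite not_full /idl /idle addbT addbF /=.
by case: (par _) => //=; rewrite eq_sym.
Qed.

Let mate0K b : involutive (mate0 b).
Proof. by case=> u j; rewrite /mate0 /= reflectK. Qed.

Let mate0_fixed b x : (mate0 b x == x) = (hop b x == x).
Proof.
rewrite hop_fixed; case: x => u j.
rewrite xpair_eqE eqxx /= /act /active /center.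
have [full_m|not_full] /= := ifPn full.
  apply/negbTE/even_reflect_free => //.
  (* [r] and [p] are the odd residues 1 and 3. *)
  by case: b; rewrite inordK // ltnS ?le_m.
by rewrite odd_reflect_fixed // negbK.
Qed.

Let mate0_tf x : mate0 true x != mate0 false x.
Proof.
case: x => u j; rewrite /mate0 xpair_eqE eqxx /=; apply: reflect_neq.
rewrite /center; have [_|not_full] := ifPn full; first exact: rp.
apply: contraNneq (idle_tf u not_full) => eq_c.
by rewrite eq_sym -odd_reflect_fixed // eq_c addrK.
Qed.

Local Close Scope ring_scope.

(** Kotzig's argument is applied twice: first to [mate0 true], avoiding [mate0 false], then to
    [mate0 false], avoiding the matching just obtained. *)
Lemma connected_matchings : exists mate : bool -> V -> V,
  [/\ forall b, involutive (mate b), forall b x, (mate b x).1 = x.1,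
      forall b x, (mate b x == x) = (hop b x == x),
      forall x, mate true x != mate false x
    & forall b (x y : V), x.1 = y.1 -> hop b x != x -> hop b y != y ->
        connect (link (hop b) (mate b)) x y].
Proof.
have [g1 [g1K g1_1 g1_fix g1_0 g1_conn]] :=
  avoiding_matching_connected (pi := fst) (hopK true) (mate0K false)
    (mate0K true) (fun=> erefl) (mate0_fixed true) mate0_tf.
have g01 x : mate0 false x != g1 x by rewrite eq_sym.
have [g2 [g2K g2_1 g2_fix g2_1' g2_conn]] :=
  avoiding_matching_connected (pi := fst) (hopK false) g1K
    (mate0K false) (fun=> erefl) (mate0_fixed false) g01.
exists (fun b => if b then g1 else g2).
by split=> [[]|[]|[]|x|[]] //; rewrite eq_sym.
Qed.

(** An active vertex has one fiber edge and one torus move, an idle one has two fiber edges. The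
    last clause retains what is needed to recognize edges of the exponential graph. *)
Lemma two_regular_pair : exists e : bool -> rel V,
  [/\ forall b, symmetric (e b), forall b, irreflexive (e b),
      forall b x, exists y z, y != z /\ e b x =1 pred2 y z,
      forall b x y, connect (e b) x y
    & (forall x y, e true x y -> ~~ e false x y) /\
      (forall b (x y : V), e b x y -> x.1 = y.1 \/
         x.2 = y.2 /\ exists2 z, (z == succ (x.1 x.2)) || (z == pred (x.1 x.2))
                              & y.1 = upd x.1 x.2 z)].
Proof.
have [mate [mateK mate1 mate_fix mate_tf mate_conn]] := connected_matchings.
pose M u b j := (mate b (u, j)).2.
have mateE b u j : mate b (u, j) = (u, M u b j).
  by rewrite [LHS]surjective_pairing mate1.
have MK u b : involutive (M u b).
  by move=> j; have := mateK b (u, j); rewrite !mateE => -[].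
have M_fix u b j : (M u b j == j) = ~~ act b u j.
  by rewrite -[RHS](hop_fixed b (u, j)) -mate_fix mateE xpair_eqE eqxx.
have M_tf u j : M u true j != M u false j.
  by have := mate_tf (u, j); rewrite !mateE xpair_eqE eqxx.
have ex_F u : exists F : bool -> rel I, (forall b, spans (M u b) (F b)) /\
    forall j k, F true j k -> ~~ F false j k.
  apply: disjoint_spans => //; have [full_m|not_full] := boolP full.
    by left=> b j; rewrite M_fix /act /active full_m.
  right; split; first by rewrite card_ord.
  exists (fun b => idl b u); split; first exact: idle_tf.
  by move=> b j; rewrite M_fix /act /active (negPf not_full) negbK.
have [F FP] := fin_all_exists ex_F.
(* A torus move always changes the first component, so this test separates the two kinds of
   edges. *)
pose e b (x y : V) := if x.1 == y.1 then F x.1 b x.2 y.2 else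
  [&& act b x.1 x.2, x.2 == y.2 & y.1 == stp b x.2 x.1].
have stpK b j : involutive (stp b j) by exact: stepK.
have stp_neq b j u : stp b j u != u by apply: step_neq.
have act_stp b u j : act b (stp b j u) j = act b u j by apply: active_step.
have eC b : symmetric (e b).
  suff sub x y : e b x y -> e b y x by move=> x y; apply/idP/idP; apply: sub.
  case: x y => [u j] [v k]; rewrite /e /= [v == u]eq_sym.
  have [<-|_] := eqVneq u v; first by have [/(_ b)[-> _ _ _ _] _] := FP u.
  by case/and3P=> uj /eqP<- /eqP->; rewrite act_stp uj stpK !eqxx.
have in_fiber b u j k : connect (F u b) j k -> connect (e b) (u, j) (u, k).
  case/connectP=> s; elim: s j => [|i s IH] j /=; first by move=> _ ->.
  case/andP=> Fji s_path def_k.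
  apply: connect_trans (IH i s_path def_k).
  by rewrite connect1 // /e /= eqxx.
have hop_conn b x : connect (e b) x (hop b x).
  case: x => u j; rewrite /hop /=; case: ifP => // uj.
  by rewrite connect1 // /e /= [u == _]eq_sym (negPf (stp_neq _ _ _)) uj !eqxx.
have mate_e b x : connect (e b) x (mate b x).
  case: x => u j; rewrite mateE in_fiber //.
  by have [/(_ b)[]] := FP u.
have active_fiber b u j k :
    act b u j -> act b u k -> connect (e b) (u, j) (u, k).
  move=> uj uk; have := mate_conn b (u, j) (u, k) erefl.
  rewrite !hop_fixed !negbK => /(_ uj uk); apply: connect_sub => x y.
  by case/orP=> /eqP->.
have eCC b := sym_connect_sym (eC b).
have act_h b u : act b u h.
  by apply: (active_hrt _ p_hrt q_hrt); rewrite mem_head.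
(* The always active vertex [(u, h)] serves as base point of its fiber. *)
have to_h b u j : connect (e b) (u, j) (u, h).
  have [uj|not_uj] := boolP (act b u j); first exact: active_fiber.
  have [/(_ b)[_ _ _ fixF _] _] := FP u.
  have /fixF[k [l [_ Mk Fjkl]]] : M u b j = j by apply/eqP; rewrite M_fix.
  rewrite M_fix negbK in Mk.
  apply: connect_trans (active_fiber _ _ _ _ Mk (act_h b u)).
  by rewrite in_fiber // connect1 // Fjkl /= eqxx.
(* A torus move in direction [j] is realized by going from [h] to [j] in the fiber, moving, and
   returning to [h]. *)
have h_conn b u v : connect (e b) (u, h) (v, h).
  have : connect (@torus_move G I succ pred par h r t p q full b) u v.
    by apply: torus_move_connected.
  case/connectP=> s; elim: s u => [|w s IH] u /= => [_ ->//|].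
  case/andP=> /existsP[j /andP[uj /eqP def_w]] s_path def_v.
  apply: connect_trans (IH w s_path def_v).
  apply: (@connect_trans _ _ (u, j)); first by rewrite eCC.
  apply: (@connect_trans _ _ (w, j)); last exact: to_h.
  by have := hop_conn b (u, j); rewrite /hop /= [act _ _ _]uj def_w.
exists e; split=> //.
- by move=> b [u j]; rewrite /e /= eqxx; have [/(_ b)[]] := FP u.
- move=> b [u j]; have [/(_ b)[_ _ movF fixF _] _] := FP u.
  have [uj|not_uj] := boolP (act b u j).
    have /movF[k Fjk] : M u b j != j by rewrite M_fix negbK.
    exists (u, k), (stp b j u, j); split.
      by rewrite xpair_eqE eq_sym (negPf (stp_neq _ _ _)).
    case=> v i; rewrite /e /= !xpair_eqE uj; have [<-|vu] := eqVneq u v.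
      by rewrite Fjk /= [u == _]eq_sym (negPf (stp_neq _ _ _)) orbF.
    by rewrite /= andbC [i == j]eq_sym.
  have /fixF[k [l [kl _ Fjkl]]] : M u b j = j by apply/eqP; rewrite M_fix.
  exists (u, k), (u, l); split; first by rewrite xpair_eqE eqxx.
  case=> v i; rewrite /e /= !xpair_eqE (negPf not_uj) [v == u]eq_sym.
  by have [_|] := eqVneq u v; rewrite ?Fjkl.
- move=> b [u j] [v k]; apply: connect_trans (to_h b u j) _.
  by apply: connect_trans (h_conn b u v) _; rewrite eCC.
split=> [[u j] [v k]|b [u j] [v k]]; rewrite /e /=.
  have [_|uv] := eqVneq u v; first by have [_] := FP u; apply.
  case/and3P=> _ /eqP<- /eqP->; rewrite eqxx /= negb_and orbC.
  by rewrite (step_disjoint _ succ_pred).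
have [->|uv] := eqVneq u v; first by left.
case/and3P=> _ /eqP<- /eqP->; right; split=> //.
exists (stp b j u j); last first.
  by apply/ffunP=> i; rewrite [RHS]ffunE; case: eqP => [->//|/eqP/stepE->].
by rewrite /stp stepEj; case: ifP => _; rewrite eqxx ?orbT.
Qed.

End TwoRegular.

(** * Passage to edge-disjoint Hamiltonian cycles *)

Lemma edge_disjoint_of_disjoint (H : sgraph) (e1 e2 : rel H) (c1 c2 : seq H) :
    symmetric e2 -> (forall x y, e1 x y -> ~~ e2 x y) ->
    cycle e1 c1 -> cycle e2 c2 ->
  edge_disjoint c1 c2.
Proof.
move=> e2C e12 e1c e2c; rewrite /edge_disjoint -setI_eq0 -subset0.
apply/subsetP=> A /setIP[/imsetP[x c1x ->] /imsetP[y c2y eq_xy]].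
have {c1x} := e12 _ _ (next_cycle e1c c1x); have {c2y} := next_cycle e2c c2y.
move: (next c1 x) (next c2 y) eq_xy => x' y' /setP eq_xy e2y.
have := eq_xy x; have := eq_xy x'; have := eq_xy y; have := eq_xy y'.
(* Equal sets mean equal or reversed edges (the two middle cases); in the outer cases [y = y'],
   which forces [x = x'] as well. *)
rewrite !inE !eqxx ?orbT /= => /orP[] /eqP y'E /orP[] /eqP yE.
- by rewrite y'E yE !orbb in e2y * => /esym/eqP->; rewrite e2y.
- by rewrite y'E yE e2C in e2y *; rewrite e2y.
- by rewrite y'E yE in e2y *; rewrite e2y.
- by rewrite y'E yE !orbb in e2y * => _ /esym/eqP->; rewrite e2y.
Qed.

Theorem theorem11 (G : sgraph) (n : nat)
    (evenG : even_graph G) (hamG : hamiltonian G) (n_ge4 : 4 <= n) :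
  exists c1 c2 : seq (exp_graph G (complete_graph n)),
    [/\ hamiltonian_cycle c1, hamiltonian_cycle c2 & edge_disjoint c1 c2].
Proof.
case: n n_ge4 => // m m_ge3.
have [c [[c_ge3 /andP[c_cycle c_uniq]] c_all]] := hamG.
have c_even : ~~ odd (size c).
  by rewrite -(card_uniqP c_uniq) (eq_card (B := G)) // => x; rewrite c_all.
(* The parity of a vertex of [G] is that of its position on [c]. *)
have [e [eC eI e2 e_conn [e_disj e_edge]]] := two_regular_pair
  (prev_next c_uniq) (next_prev c_uniq)
  (fun x => odd_index_next c_uniq c_all x c_even)
  (fun x => next_neq_prev c_uniq c_all x c_ge3) (next_connect c_uniq c_all)
  m_ge3.
(* Edges inside a fiber come from the complete graph, all others from a step along [c]. *)
have e_exp b : subrel (e b) (@exp_edge G (complete_graph m.+1)).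
  move=> [u j] [v k] euv; have := euv; rewrite /exp_edge.
  case/e_edge => /= [eq_uv|[<- [z z_next ->]]].
    rewrite eq_uv in euv *; have jk : j != k.
      by apply: contraTneq euv => ->; rewrite eI.
    by rewrite (negPf jk) /= /complete_edge jk; apply/forallP.
  rewrite eqxx orbF ffunE eqxx /=; apply/andP; split.
    case/orP: z_next => /eqP->; first exact: next_cycle.
    by rewrite edge_sym; apply: prev_cycle.
  by apply/forallP=> i; apply/implyP=> ij; rewrite ffunE (negPf ij).
have /card_gt0P[x0 _] : 0 < #|G|.
  by rewrite -(eq_card c_all) (card_uniqP c_uniq) (ltn_trans _ c_ge3).
have ham_e b := two_regular_hamiltonian ([ffun=> x0], ord0)
  (eC b) (eI b) (e2 b) (e_conn b).
have [c1 [c1_ge3 /andP[c1_cycle c1_uniq] c1_all]] := ham_e true.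
have [c2 [c2_ge3 /andP[c2_cycle c2_uniq] c2_all]] := ham_e false.
exists c1, c2; split; last 1 first.
- exact: (@edge_disjoint_of_disjoint (exp_graph G (complete_graph m.+1))
            _ _ _ _ (eC false) e_disj c1_cycle c2_cycle).
- split=> //; split=> //; apply/andP; split=> //.
  exact: (sub_cycle (@e_exp true)) c1_cycle.
- split=> //; split=> //; apply/andP; split=> //.
  exact: (sub_cycle (@e_exp false)) c2_cycle.
Qed.
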